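(* Let $s\ge2$, $\beta\ge1$, $m\ge2\beta s$, and $X_\star=\{-2m,\dots,2m\}^d$. Consider the signal class $$\mathcal S=\big\{(\vartheta,a):|\vartheta|=|a|=s,\ \min_\ell|a_\ell|=1,\ m\Delta(\vartheta)\ge\beta\big\}\subset(\mathbb T^d\times\mathbb C)^s.$$ There is a constant $c_d>0$ depending only on $d$ such that for any $p\in[1,\infty]$ and $\epsilon\le c_dm^{d/p}$, with the noise class $\mathcal N=\{\eta:\|\eta\|_{\ell^p(X_\star)}\le\epsilon\}$, we have $$\Theta_\star(\mathcal S,\mathcal N)\gtrsim_d\frac{\epsilon}{m^{1+d/p}}\qquad\text{and}\qquad A_\star(\mathcal S,\mathcal N)\gtrsim_d\frac{\epsilon}{m^{d/p}}.$$
   Context: Notation. $d\ge 1$ and $m$ are integers. $\mathbb T^d=(\mathbb R/\mathbb Z)^d$ with $|\omega|=\min_{n\in\mathbb Z^d}|\omega+n|$ (Euclidean norm). $\vartheta=\{\theta_\ell\}_{\ell=1}^s$, $a=\{a_\ell\}_{\ell=1}^s$; $\Delta(\vartheta)=\min_{j\ne k}|\theta_j-\theta_k|$. $u\gtrsim_dv$ means $u\ge cv$ for a constant $c>0$ depending only on $d$. Minimax errors. The parameter space is $\mathcal P=\{(\vartheta,a):|\vartheta|=|a|=s,\ \min_\ell|a_\ell|=1\}\subset(\mathbb T^d\times\mathbb C)^s$. For $(\vartheta,a)\in\mathcal P$ and $\eta$ a function on $X_\star$, the data are $\tilde y(\vartheta,a,\eta)=(y+\eta)|_{X_\star}$ with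 $y(x)=\sum_{\ell=1}^sa_\ell e^{2\pi i\theta_\ell\cdot x}$; the data space is $\mathcal Y=\{\tilde y(\vartheta,a,\eta):(\vartheta,a)\in\mathcal S,\eta\in\mathcal N\}$. A method is any measurable function $\psi:\mathcal Y\to\mathcal P$; write $(\hat\vartheta,\hat a)=\psi(\tilde y(\vartheta,a,\eta))$, where $\hat\vartheta$ (and correspondingly $\hat a$) is indexed to best match $\vartheta$, i.e. by a permutation minimizing $\max_\ell|\theta_\ell-\hat\theta_\ell|$. Set $$\Theta(\psi,\mathcal S,\mathcal N)=\sup_{(\vartheta,a)\in\mathcal S}\sup_{\eta\in\mathcal N}\max_\ell|\theta_\ell-\hat\theta_\ell|,\qquad A(\psi,\mathcal S,\mathcal N)=\sup_{(\vartheta,a)\in\mathcal S}\sup_{\eta\in\mathcal N}\max_\ell|a_\ell-\hat a_\ell|,$$ $\Theta_\star(\mathcal S,\mathcal N)=\inf_\psi\Theta(\psi,\mathcal S,\mathcal N)$ and $A_\star(\mathcal S,\mathcal N)=\inf_\psi A(\psi,\mathcal S,\mathcal N)$, the infima being over all methods. *)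

(* Defs.v *)
From HB Require Import structures.
From mathcomp Require Import all_boot all_order all_algebra all_fingroup.
From mathcomp Require Import generic_quotient ring_quotient archimedean complex.
From mathcomp Require Import all_classical all_reals all_analysis.

Set Implicit Arguments.
Unset Strict Implicit.
Unset Printing Implicit Defensive.

Import Order.TTheory GRing.Theory Num.Theory.

Local Open Scope classical_set_scope.
Local Open Scope ring_scope.

Definition int_pred (R : realType) : pred R := fun x => x \is a Num.int.

Fact int_pred_zmod_closed (R : realType) : zmod_closed (@int_pred R).
Proof. by split=> [|x y xZ yZ]; [exact: int_num0|exact: rpredB]. Qed.

HB.instance Definition _ (R : realType) :=
  GRing.isZmodClosed.Build R (@int_pred R) (@int_pred_zmod_closed R).

(* R / Z; its Borel sets are the sets with a Borel preimage in R. *)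
Definition circle (R : realType) : Type :=
  {ideal_quot (GRing.ZmodClosed.clone R (@int_pred R) _)}.

HB.instance Definition _ (R : realType) := GRing.Zmodule.on (circle R).
HB.instance Definition _ (R : realType) := EqQuotient.on (circle R).
HB.instance Definition _ (R : realType) := isPointed.Build (circle R) 0.

Definition circle_measurable (R : realType) : set (set (circle R)) :=
  [set A | measurable [set x : R | A (\pi_(circle R)%qT x)]].

Fact circle_measurable0 (R : realType) : @circle_measurable R set0.
Proof. exact: measurable0. Qed.

Fact circle_measurableC (R : realType) (A : set (circle R)) :
  circle_measurable A -> circle_measurable (~` A).
Proof. by move=> mA; exact: (measurableC mA). Qed.

Fact circle_measurable_bigcup (R : realType) (F : (set (circle R))^nat) :
  (forall i, circle_measurable (F i)) -> circle_measurable (\bigcup_i F i).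
Proof. by move=> mF; exact: bigcup_measurable (fun i _ => mF i). Qed.

HB.instance Definition _ (R : realType) :=
  isMeasurable.Build default_measure_display (circle R)
    (@circle_measurable0 R) (@circle_measurableC R)
    (@circle_measurable_bigcup R).

HB.instance Definition _ (R : realType) := isPointed.Build R[i] 0.

Definition complex_pair (R : realType) (z : R[i]) : R * R :=
  (complex.Re z, complex.Im z).

(* The Borel sigma-algebra of C, carried over from R^2. *)
HB.instance Definition _ (R : realType) :=
  Measurable.copy R[i] (g_sigma_algebra_preimageType (@complex_pair R)).

Definition cmod (R : realType) (z : R[i]) : R := ComplexField.Normc.normc z.

Definition expi (R : realType) (t : R) : R[i] := (cos t +i* sin t)%C.

Definition torus (R : realType) (d : nat) := d.-tuple (circle R).

Definition torus_sub (R : realType) (d : nat) (w w' : torus R d) : torus R d :=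
  [tuple tnth w j - tnth w' j | j < d].

(* The minimum over Z^d exists and does not depend on the representative. *)
Definition torus_norm (R : realType) (d : nat) (w : torus R d) : R :=
  inf [set Num.sqrt (\sum_(j < d) (repr (tnth w j) + (n j)%:~R) ^+ 2)
      | n in [set: 'I_d -> int]].

Definition torus_dist (R : realType) (d : nat) (w w' : torus R d) : R :=
  torus_norm (torus_sub w w').

(* X_star = {-2m, ..., 2m}^d; [grid_coord x j] is the j-th coordinate of x. *)
Definition grid (d m : nat) := {ffun 'I_d -> 'I_(4 * m).+1}.

Definition grid_coord (d m : nat) (x : grid d m) (j : 'I_d) : int :=
  (x j : nat)%:Z - (2 * m)%N%:Z.

Definition data (R : realType) (d m : nat) := grid d m -> R[i].

(* The Borel sigma-algebra of the finite product C^(X_star). *)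
Definition data_measurable (R : realType) (d m : nat) :
    set (set (data R d m)) :=
  <<s \bigcup_(x in [set: grid d m])
        preimage_set_system setT (fun y : data R d m => y x) measurable >>.

(* (T^d x C)^s *)
Definition config (R : realType) (d s : nat) := s.-tuple (torus R d * R[i]).

Section Config.
Variables (R : realType) (d s : nat).
Implicit Types (q : config R d s) (l : 'I_s).

Definition freq q l : torus R d := (tnth q l).1.

Definition ampl q l : R[i] := (tnth q l).2.

(* Minima of finite families are written as infima. *)
Definition min_ampl q : R := inf (range (fun l => cmod (ampl q l))).

Definition separation q : R :=
  inf [set torus_dist (freq q jk.1) (freq q jk.2)
      | jk in [set jk : 'I_s * 'I_s | jk.1 != jk.2]].

(* |vartheta| = s means that the s frequencies are pairwise distinct. *)
Definition param_space : set (config R d s) :=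
  [set q | injective (freq q) /\ min_ampl q = 1].

Definition signal_class (m : nat) (beta : R) : set (config R d s) :=
  [set q | param_space q /\ beta <= m%:R * separation q].

Definition freq_error q q' (pi : 'S_s) : R :=
  \big[Num.max/0]_(l < s) torus_dist (freq q l) (freq q' (pi l)).

Definition ampl_error q q' (pi : 'S_s) : R :=
  \big[Num.max/0]_(l < s) cmod (ampl q l - ampl q' (pi l)).

(* [match_ q q'] is the indexing of the estimate q' used to compare it with q;
   when several permutations minimize the frequency error, any may be chosen. *)
Definition best_match (match_ : config R d s -> config R d s -> 'S_s) : Prop :=
  forall q q' (pi : 'S_s), freq_error q q' (match_ q q') <= freq_error q q' pi.

End Config.

Section Minimax.
Variables (R : realType) (d s m : nat).
Implicit Types (q : config R d s) (eta : data R d m).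

Definition signal q (x : grid d m) : R[i] :=
  \sum_(l < s) ampl q l *
    expi (2 * pi *
          \sum_(j < d) repr (tnth (freq q l) j) * (grid_coord x j)%:~R).

Definition noisy_data q eta : data R d m := fun x => signal q x + eta x.

Variables (S : set (config R d s)) (N : set (data R d m)).

Definition data_space : set (data R d m) :=
  [set noisy_data q eta | q in S & eta in N].

(* Measurable maps from [data_space] (with the trace sigma-algebra) to
   [param_space], represented by functions whose values off [data_space] are
   irrelevant.  [measurable_fun] is not used because it is vacuous on a domain
   that is not known to be measurable. *)
Definition is_method (psi : data R d m -> config R d s) : Prop :=
  (forall y, data_space y -> param_space (psi y)) /\
  (forall B : set (config R d s), measurable B ->
     strace (@data_measurable R d m) data_space
       (psi @^-1` B `&` data_space)).

Variable match_ : config R d s -> config R d s -> 'S_s.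

Definition worst_freq_error (psi : data R d m -> config R d s) : \bar R :=
  ereal_sup [set (let q' := psi (noisy_data q eta) in
                  freq_error q q' (match_ q q'))%:E | q in S & eta in N].

Definition worst_ampl_error (psi : data R d m -> config R d s) : \bar R :=
  ereal_sup [set (let q' := psi (noisy_data q eta) in
                  ampl_error q q' (match_ q q'))%:E | q in S & eta in N].

Definition minimax_freq_error : \bar R :=
  ereal_inf [set worst_freq_error psi | psi in is_method].

Definition minimax_ampl_error : \bar R :=
  ereal_inf [set worst_ampl_error psi | psi in is_method].

End Minimax.

(* The l^p norm on X_star for 1 <= p <= +oo. *)
Definition lp_norm (R : realType) (d m : nat) (p : \bar R)
    (eta : data R d m) : R :=
  match p with
  | r%:E => (\sum_(x : grid d m) cmod (eta x) `^ r) `^ r^-1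
  | _ => \big[Num.max/0]_(x : grid d m) cmod (eta x)
  end.

Definition noise_class (R : realType) (d m : nat) (p : \bar R) (eps : R) :
    set (data R d m) :=
  [set eta | lp_norm p eta <= eps].

(* d / p, equal to 0 for p = +oo. *)
Definition dim_div (R : realType) (d : nat) (p : \bar R) : R :=
  fine (d%:R%:E / p)%E.

(* Main.v *)
Require Import Defs.
From mathcomp Require Import all_boot all_order all_algebra all_fingroup.
From mathcomp Require Import generic_quotient ring_quotient complex archimedean.
From mathcomp Require Import ring lra.
From mathcomp Require Import all_classical all_reals all_analysis.

Set Implicit Arguments.
Unset Strict Implicit.
Unset Printing Implicit Defensive.

Import Order.TTheory GRing.Theory Num.Theory.
Import numFieldNormedType.Exports.

Local Open Scope ring_scope.

(* Two-point method.  If y1 and y2 are the signals of two configurations and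
   half of y1 - y2 is admissible noise, then both configurations can produce the
   datum (y1 + y2) / 2, so every method errs on one of them by at least half of
   their distance, where distance means up to permutation of the indices.
   Both pairs perturb s unit spikes on the diagonal of the torus, at spacing
   2 beta / m per coordinate (they fit since m >= 2 beta s).  Displacing one
   frequency by h <= beta / m keeps the separation and changes each sample by
   O(m h); raising one amplitude from 1 to 1 + t changes each sample by t in
   modulus.  A function bounded by M on the grid has l^p norm at most
   M (4m + 1)^(d/p), which is O(M m^(d/p)) because d/p <= d. *)

(** * Modulus and phase estimates in C *)

Section Trigonometry.
Variable R : realType.
Implicit Types (a b t : R).

Lemma lipschitz1_sin_cos a b :
  `|sin a - sin b| <= `|a - b| /\ `|cos a - cos b| <= `|a - b|.
Proof.
wlog ab : a b / b <= a => [hw|].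
  have [/hw//|/ltW/hw] := leP b a.
  by rewrite (distrC a) (distrC (cos a)) (distrC (sin a)).
have bound (f df : R -> R) : (forall x : R, is_derive x (1 : R) (f : R -> R) (df x : R)) ->
    (forall x, `|df x| <= 1) -> `|f a - f b| <= `|a - b|.
  move=> fdf df1; have [|c _ ->] := @MVT_segment R f df _ _ ab.
    by apply: derivable_within_continuous => x _; apply: ex_derive.
  by rewrite normrM ler_piMl.
split; first by apply: (bound _ cos) => x; exact: cos_max.
by apply: (bound _ (fun x => - sin x)) => // x; rewrite normrN sin_max.
Qed.

Lemma cmod_le_ReIm (z : R[i]) : cmod z <= `|complex.Re z| + `|complex.Im z|.
Proof.
case: z => x y /=; rewrite /cmod /=.
rewrite -[leRHS]ger0_norm ?addr_ge0// -sqrtr_sqr ler_wsqrtr// sqrrD.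
rewrite !real_normK ?num_real// lerD2r lerDl mulrn_wge0// mulr_ge0//.
Qed.

Lemma cmod_real (x : R) : cmod x%:C%C = `|x|.
Proof. by rewrite /cmod /= expr0n addr0 sqrtr_sqr. Qed.

Lemma cmod_expi t : cmod (expi t) = 1.
Proof. by rewrite /cmod /= cos2Dsin2 sqrtr1. Qed.

Lemma cmod_ge0 (z : R[i]) : 0 <= cmod z.
Proof. by case: z => x y; rewrite /cmod /= sqrtr_ge0. Qed.

Lemma cmodM (z w : R[i]) : cmod (z * w) = cmod z * cmod w.
Proof. exact: ComplexField.Normc.normcM. Qed.

Lemma cmodD (z w : R[i]) : cmod (z + w) <= cmod z + cmod w.
Proof. exact: le_normcD. Qed.

Lemma cmodN (z : R[i]) : cmod (- z) = cmod z.
Proof. exact: normcN. Qed.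

(** The factor 2 (1 would be optimal) comes from bounding the modulus by the sum of the absolute
    real and imaginary parts. *)
Lemma cmod_expiB a b : cmod (expi a - expi b) <= 2 * `|a - b|.
Proof.
apply: (le_trans (cmod_le_ReIm _)); have [? ?] := lipschitz1_sin_cos a b.
by rewrite mulrDl mul1r lerD.
Qed.

Lemma expiD_2pi_int t z : z \is a Num.int ->
  expi (2 * pi * (t + z)) = expi (2 * pi * t).
Proof.
have per (n : nat) (u : R) : expi (u + 2 * pi * n%:R) = expi u.
  rewrite mulr_natl mulr_natr.
  by rewrite /expi !(periodicn (@cosD2pi R), periodicn (@sinD2pi R)).
move=> /intrP[[] n ->]; rewrite mulrDr; first exact: per.
by rewrite NegzE mulrNz -[in RHS](subrK (2 * pi * n.+1%:R) (2 * pi * t)) per mulrN.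
Qed.

End Trigonometry.

(** * The quotient norm on R/Z and its comparison with the torus norm *)

Section CircleNorm.
Variable R : realType.
Implicit Types (x y c : R) (v w : circle R).

Local Notation picirc := (\pi_(circle R)%qT).

(** The infimum runs over all real lifts, so estimates can be made on any convenient lift instead of
    [repr w]. *)
Definition circle_norm w : R := inf [set `|x| | x in [set x | picirc x = w]]%classic.

Lemma eq_picirc x y : picirc x = picirc y <-> x - y \is a Num.int.
Proof.
have := Quotient.idealrBE (GRing.ZmodClosed.clone R (@int_pred R) _) x y.
rewrite [X in X = _]/= => E; split=> [e|i].
  by move: E; rewrite -[X in _ = X]/(picirc x == picirc y) e eqxx => E'; exact: E'.
by apply/eqP; rewrite -[X in is_true X]E.
Qed.

Lemma circle_norm_le x : circle_norm (picirc x) <= `|x|.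
Proof.
by apply: ge_inf; [exists 0 => _ [y _ <-]|exists x].
Qed.

Lemma le_circle_norm c w :
  (forall x, picirc x = w -> c <= `|x|) -> c <= circle_norm w.
Proof.
move=> h; apply: lb_le_inf => [|_ [x /h ? <-]//].
by exists `|repr w|, (repr w); rewrite //= reprK.
Qed.

(** Any other lift differs from [x] by a nonzero integer, so its absolute value is at least 1 -
    |x|. *)
Lemma le_circle_norm_pi c x : c <= `|x| -> `|x| <= 1 - c ->
  c <= circle_norm (picirc x).
Proof.
move=> cx xc; apply: le_circle_norm => y /eq_picirc yx.
have [/eqP|/(norm_intr_ge1 yx) h] := eqVneq (y - x) 0.
  by rewrite subr_eq0 => /eqP->.
by have := ler_normB y x; lra.
Qed.

(** Subtracting [v] in both terms fits the later use, where [u] and [w] are true frequencies and [v]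
    is their common estimate. *)
Lemma circle_normB u v w :
  circle_norm (u - w) <= circle_norm (u - v) + circle_norm (w - v).
Proof.
rewrite -lerBlDl; apply: le_circle_norm => y yE.
rewrite lerBlDl -lerBlDr; apply: le_circle_norm => x xE.
rewrite lerBlDr; apply: le_trans (ler_normB x y).
suff -> : u - w = picirc (x - y) by exact: circle_norm_le.
by rewrite raddfB /= xE yE opprB addrA subrK.
Qed.

Lemma circle_norm_le_torus d (w : torus R d) (j : 'I_d) :
  circle_norm (tnth w j) <= torus_norm w.
Proof.
apply: lb_le_inf; first by eexists; exists (fun=> 0).
move=> _ [n _ <-]; set f := fun k => _.
apply: (@le_trans _ _ `|repr (tnth w j) + (n j)%:~R|).
  suff {1}-> : tnth w j = picirc (repr (tnth w j) + (n j)%:~R).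
    exact: circle_norm_le.
  rewrite -[LHS]reprK; apply/eq_picirc; rewrite opprD addrA subrr sub0r.
  by rewrite rpredN intr_int.
rewrite -sqrtr_sqr ler_wsqrtr// (bigD1 j)//= lerDl sumr_ge0// => k _.
exact: sqr_ge0.
Qed.

Lemma circle_norm_le_torus_dist d (v w : torus R d) (j : 'I_d) :
  circle_norm (tnth v j - tnth w j) <= torus_dist v w.
Proof.
by have := circle_norm_le_torus (torus_sub v w) j; rewrite tnth_mktuple.
Qed.

End CircleNorm.

(** * The l^p norm of a bounded function on the grid *)

Section LpNorm.
Variables (R : realType) (d m : nat).

Lemma dim_div_ge0 (p : \bar R) : (1%:E <= p)%E -> 0 <= dim_div d p.
Proof. by move=> p1; rewrite fine_ge0// mule_ge0// inve_ge0 (le_trans _ p1)// lee01. Qed.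

Lemma dim_div_le (p : \bar R) : (1%:E <= p)%E -> dim_div d p <= d%:R.
Proof.
case: p => [r||]//; rewrite /dim_div.
- rewrite lee_fin => r1; have r0 : 0 < r by exact: lt_le_trans r1.
  rewrite inver gt_eqF//= ler_piMr// invf_le1//.
- by rewrite invey mule0.
Qed.

Lemma lp_norm_le (p : \bar R) (M : R) (eta : data R d m) : (1%:E <= p)%E ->
  0 <= M -> (forall x, cmod (eta x) <= M) ->
  lp_norm p eta <= M * (4 * m).+1%:R `^ dim_div d p.
Proof.
move=> p1 M0 etaM; case: p p1 => [r||]//=.
- rewrite lee_fin => r1; have r0 : 0 < r by exact: lt_le_trans r1.
  have cardE : #|grid d m| = ((4 * m).+1 ^ d)%N by rewrite card_ffun !card_ord.
  have -> : dim_div d r%:E = d%:R * r^-1 :> R by rewrite /dim_div inver gt_eqF.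
  (* The bound is the l^r norm of the constant [M], since the grid has (4m+1)^d points. *)
  have -> : M * (4 * m).+1%:R `^ (d%:R * r^-1) =
      (\sum_(x : grid d m) M `^ r) `^ r^-1.
    rewrite sumr_const -[#|_|]/(#|grid d m|) cardE -(mulr_natr (M `^ r)) powRM ?powR_ge0//.
    by rewrite -powRrM divff ?gt_eqF// powRr1// natrX -powR_mulrn// -powRrM.
  have powr_ge0 (f : grid d m -> R) : 0 <= \sum_x f x `^ r.
    by apply: sumr_ge0 => x _; exact: powR_ge0.
  apply: ge0_ler_powR; rewrite ?nnegrE ?invr_ge0 ?(ltW r0) ?powr_ge0//.
  apply: ler_sum => x _.
  by apply: ge0_ler_powR; rewrite ?nnegrE ?(ltW r0) ?cmod_ge0.
- move=> _; rewrite /dim_div invey mule0 powRr0 mulr1.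
  by apply: bigmax_le.
Qed.

(** Combining 4m + 1 <= 5m with d/p <= d gives a factor that depends on d but not on p. *)
Lemma grid_side_powR_le (p : \bar R) : (1%:E <= p)%E -> (0 < m)%N ->
  (4 * m).+1%:R `^ dim_div d p <= 5 ^+ d * (m%:R : R) `^ dim_div d p.
Proof.
move=> p1 m0; have D0 := dim_div_ge0 p1.
apply: (@le_trans _ _ ((5 * m%:R) `^ dim_div d p)).
  apply: ge0_ler_powR; rewrite ?nnegrE// -natrM ler_nat.
  by rewrite -addn1 (mulnDl 4 1) leq_add2l mul1n.
rewrite powRM// ler_wpM2r ?powR_ge0// -powR_mulrn//.
by rewrite ler_powR ?dim_div_le// ler1n.
Qed.

End LpNorm.

(** * Reduction of the minimax error to two configurations *)

Section TwoPoint.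
Variables (R : realType) (d s m : nat).
Variables (S : set (config R d s)) (N : set (data R d m)).
Variable match_ : config R d s -> config R d s -> 'S_s.
Variables q1 q2 : config R d s.
Hypotheses (Sq1 : S q1) (Sq2 : S q2).

Let half_gap (x : grid d m) : R[i] := (signal q2 x - signal q1 x) / 2.

Hypotheses (Nhalf : N half_gap) (NNhalf : N (fun x => - half_gap x)).

Lemma two_point_data : noisy_data q1 half_gap = noisy_data q2 (fun x => - half_gap x).
Proof. by apply/funext => x; rewrite /noisy_data /half_gap; field. Qed.

(** Both configurations yield the same datum, hence the same estimate [q'], so one of the two errors
    is at least [e]. The permutations are quantified separately because [q1] and [q2] may be matched
    to [q'] differently. *)
Lemma two_point_lower_bound (err : config R d s -> config R d s -> 'S_s -> R) (e : R) :
  (forall q' pi1 pi2, 2 * e <= err q1 q' pi1 + err q2 q' pi2) ->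
  (e%:E <= ereal_inf [set ereal_sup
      [set (let q' := psi (noisy_data q eta) in err q q' (match_ q q'))%:E
        | q in S & eta in N]
    | psi in is_method S N])%classic%E.
Proof.
move=> herr; apply/ereal_infP => _ [psi _ <-].
set q' := psi (noisy_data q1 half_gap).
have := herr q' (match_ q1 q') (match_ q2 q').
have [h _|h1 h] := leP e (err q1 q' (match_ q1 q')).
  apply: ereal_sup_ge; exists (err q1 q' (match_ q1 q'))%:E; last by rewrite lee_fin.
  by exists q1 => //; exists half_gap.
apply: ereal_sup_ge; exists (err q2 q' (match_ q2 q'))%:E; last by rewrite lee_fin; lra.
exists q2 => //; exists (fun x => - half_gap x) => //=.
by rewrite -two_point_data.
Qed.

End TwoPoint.

(** * Distance of two configurations up to permutation *)

Section Errors.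
Variables (R : realType) (d s : nat).
Implicit Types (q : config R d s).

(** Triangle inequality through the estimated spike matched to [l]: [k] is the index of [q2] matched
    to that same spike. It is not known in advance, so the hypothesis covers all [k]. *)
Lemma freq_error_lower_bound q1 q2 q' (pi1 pi2 : 'S_s) (j : 'I_d) (l : 'I_s) (h : R) :
  (forall k, h <= circle_norm (tnth (freq q1 l) j - tnth (freq q2 k) j)) ->
  h <= freq_error q1 q' pi1 + freq_error q2 q' pi2.
Proof.
move=> hh; set k := (pi2^-1)%g (pi1 l).
apply: (le_trans (hh k)).
apply: (le_trans (circle_normB _ (tnth (freq q' (pi1 l)) j) _)).
have pk : pi2 k = pi1 l by rewrite /k permKV.
apply: lerD; apply: (le_trans (circle_norm_le_torus_dist _ _ _)).
  exact: (le_bigmax _ (fun l => torus_dist (freq q1 l) (freq q' (pi1 l)))).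
rewrite -pk.
exact: (le_bigmax _ (fun l => torus_dist (freq q2 l) (freq q' (pi2 l)))).
Qed.

(** The fixed index lies in [q2] here: the raised amplitude will differ from every amplitude of
    [q1], whereas the amplitude 1 occurs in both configurations. *)
Lemma ampl_error_lower_bound q1 q2 q' (pi1 pi2 : 'S_s) (l : 'I_s) (h : R) :
  (forall k, h <= cmod (ampl q2 l - ampl q1 k)) ->
  h <= ampl_error q1 q' pi1 + ampl_error q2 q' pi2.
Proof.
move=> hh; set k := (pi1^-1)%g (pi2 l).
have pk : pi1 k = pi2 l by rewrite /k permKV.
apply: (le_trans (hh k)); rewrite [leRHS]addrC.
rewrite -(subrKA (ampl q' (pi2 l))); apply: (le_trans (cmodD _ _)).
apply: lerD; first exact: (le_bigmax _ (fun l => cmod (ampl q2 l - ampl q' (pi2 l)))).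
rewrite -cmodN opprB -pk.
exact: (le_bigmax _ (fun l => cmod (ampl q1 l - ampl q' (pi1 l)))).
Qed.

End Errors.

(** * Spikes on the diagonal, with spike 0 perturbed *)

Section LineConfig.
Variables (R : realType) (d s : nat).
Implicit Types (g delta t : R) (l k : 'I_s).

Definition line_node g delta l : R := g * l%:R + delta *+ (l == 0 :> nat).

(** With equal coordinates, any single coordinate certifies the separation, and the phase at [x]
    depends only on the sum of the coordinates of [x]. *)
Definition line_config g delta t : config R d s :=
  [tuple ([tuple \pi_(circle R)%qT (line_node g delta l) | j < d],
          (1 + t *+ (l == 0 :> nat))%:C%C) | l < s].

Lemma tnth_freq_line g delta t l (j : 'I_d) :
  tnth (freq (line_config g delta t) l) j =
  \pi_(circle R)%qT (line_node g delta l).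
Proof. by rewrite /freq tnth_mktuple tnth_mktuple. Qed.

Lemma ampl_line g delta t l :
  ampl (line_config g delta t) l = (1 + t *+ (l == 0 :> nat))%:C%C.
Proof. by rewrite /ampl tnth_mktuple. Qed.

(** Unperturbed lifts differ by between g and 1 - g, as s g <= 1 leaves room for wrapping around;
    the displacements alter this by at most g/2. Two values [delta], [delta'] cover both separation
    within a configuration and comparison of two configurations. *)
Lemma circle_norm_line_node g delta delta' l k : 0 < g -> s%:R * g <= 1 ->
  0 <= delta <= g / 2 -> 0 <= delta' <= g / 2 -> l != k ->
  g / 2 <= circle_norm (\pi_(circle R)%qT (line_node g delta l) -
                        \pi_(circle R)%qT (line_node g delta' k)).
Proof.
move=> g0 sg /andP[d0 dg] /andP[d0' dg'] lk; rewrite -raddfB.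
set e := delta *+ (l == 0 :> nat) - delta' *+ (k == 0 :> nat).
have eg : `|e| <= g / 2.
  by rewrite /e; do 2 case: eqVneq => _; rewrite ?mulr1n ?mulr0n ler_norml; lra.
have -> : line_node g delta l - line_node g delta' k = g * (l%:R - k%:R) + e.
  by rewrite /line_node /e; lra.
have z1 : 1 <= `|l%:R - k%:R : R|.
  by apply: norm_intr_ge1; rewrite ?rpredB ?natr_int// subr_eq0 eqr_nat.
have zs : `|l%:R - k%:R : R| <= s%:R - 1.
  have ub (i : 'I_s) : i%:R <= s%:R - 1 :> R.
    by rewrite lerBrDr natr1 ler_nat ltn_ord.
  have := (ub l, ub k, ler0n R l, ler0n R k) => -[[[? ?] ?] ?].
  by rewrite ler_norml; lra.
have gz1 : g <= `|g * (l%:R - k%:R)|.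
  by rewrite normrM gtr0_norm// ler_peMr// ltW.
have gzs : `|g * (l%:R - k%:R)| <= 1 - g.
  by rewrite normrM gtr0_norm//; nra.
have n1 := ler_normD (g * (l%:R - k%:R)) e.
have n2 := ler_normB (g * (l%:R - k%:R) + e) e.
by rewrite addrK in n2; apply: le_circle_norm_pi; lra.
Qed.

Lemma line_config_signal_class m (beta delta t : R) (hd : (0 < d)%N) :
  let g := 2 * beta / m%:R in
  (2 <= s)%N -> (0 < m)%N -> 0 < g -> s%:R * g <= 1 ->
  0 <= delta <= g / 2 -> 0 <= t ->
  signal_class m beta (line_config g delta t).
Proof.
move=> g s2 m0 g0 sg dg t0; set q := line_config _ _ _.
have sep l k : l != k ->
    g / 2 <= circle_norm (tnth (freq q l) (Ordinal hd) - tnth (freq q k) (Ordinal hd)).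
  by move=> lk; rewrite !tnth_freq_line circle_norm_line_node.
have cmod_ampl l : cmod (ampl q l) = 1 + t *+ (l == 0 :> nat).
  by rewrite ampl_line cmod_real ger0_norm// addr_ge0// mulrn_wge0.
have s1 : (0 < s)%N by exact: ltn_trans s2.
split; first split.
- move=> l k lk; apply/eqP/negPn/negP => /sep; rewrite lk subrr.
  have := circle_norm_le (0 : R); rewrite raddf0 normr0; lra.
- apply/le_anti/andP; split.
    apply: ge_inf; first by exists 0 => _ [l _ <-]; exact: cmod_ge0.
    (* [Ordinal s2] is index 1, whose amplitude remains 1. *)
    by exists (Ordinal s2); rewrite // cmod_ampl addr0.
  apply: lb_le_inf; first by exists (cmod (ampl q (Ordinal s1))), (Ordinal s1).
  by move=> _ [l _ <-]; rewrite cmod_ampl lerDl mulrn_wge0.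
- have bE : beta = m%:R * (g / 2).
    by rewrite /g; field; rewrite pnatr_eq0 -lt0n.
  rewrite [leLHS]bE ler_pM2l ?ltr0n//; apply: lb_le_inf.
    by eexists; exists (Ordinal s1, Ordinal s2).
  by move=> _ [[l k] /= lk <-]; exact: le_trans (sep _ _ lk) (circle_norm_le_torus_dist _ _ _).
Qed.

Lemma signal_line g delta t m (x : grid d m) :
  signal (line_config g delta t) x =
  \sum_(l < s) (1 + t *+ (l == 0 :> nat))%:C%C *
    expi (2 * pi * (line_node g delta l * \sum_(j < d) (grid_coord x j)%:~R)).
Proof.
apply: eq_bigr => l _; rewrite ampl_line; congr (_ * _).
set u := line_node _ _ _.
rewrite -(subrK (u * \sum_(j < d) (grid_coord x j)%:~R) (\sum_j _)) addrC.
(* [repr] of a node and [line_node] differ by an integer; as grid coordinates are integers, the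
   phase changes by a multiple of 2 pi. *)
apply: expiD_2pi_int; rewrite mulr_sumr -sumrB rpred_sum// => j _.
rewrite -mulrBl rpredM ?intr_int// tnth_freq_line.
by apply/eq_picirc; rewrite reprK.
Qed.

Lemma norm_sum_grid_coord m (x : grid d m) :
  `|\sum_(j < d) (grid_coord x j)%:~R : R| <= d%:R * (2 * m%:R).
Proof.
apply: (le_trans (ler_norm_sum _ _ _)).
apply: (@le_trans _ _ (\sum_(j < d) (2 * m%:R))); last first.
  by rewrite sumr_const card_ord -[leLHS]mulr_natl.
apply: ler_sum => j _; rewrite /grid_coord rmorphB /= -!pmulrn natrM.
have : ((x j)%:R : R) <= 4 * m%:R by rewrite -natrM ler_nat -ltnS ltn_ord.
by have := ler0n R (x j); rewrite ler_norml; lra.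
Qed.

(** Only the term of spike 0 survives the subtraction. The constant is 8 pi d m = 2 * 2 pi * 2 d m:
    Lipschitz factor, frequency scaling, and bound on the coordinate sum. *)
Lemma cmod_signal_line_gap g delta t m (x : grid d m) : (0 < s)%N ->
  0 <= delta -> 0 <= t ->
  cmod (signal (line_config g delta t) x - signal (line_config g 0 0) x) <=
  t + 8 * pi * d%:R * m%:R * delta.
Proof.
move=> s0 d0 t0; rewrite !signal_line; set X := \sum_(j < d) _.
rewrite -sumrB (bigD1 (Ordinal s0))// big1 => [|l l0]; last first.
  have l0' : (l == 0 :> nat) = false by apply: contraNF l0 => /eqP ?; apply/eqP/val_inj.
  by rewrite /line_node l0' subrr.
have n0 a : line_node g a (Ordinal s0) = a by rewrite /line_node mulr0 add0r.
rewrite [X in cmod X]addr0 !n0 eqxx mulr1n mul0rn addr0 mul0r mulr0 mul1r.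
have -> : (1 + t)%:C%C * expi (2 * pi * (delta * X)) - expi 0 =
  t%:C%C * expi (2 * pi * (delta * X)) + (expi (2 * pi * (delta * X)) - expi 0).
  by rewrite rmorphD rmorph1; ring.
apply: (le_trans (cmodD _ _)); apply: lerD.
  by rewrite cmodM cmod_expi mulr1 cmod_real ger0_norm.
apply: (le_trans (cmod_expiB _ _)); rewrite subr0 !normrM.
have := norm_sum_grid_coord x; rewrite -/X => hX.
rewrite (ger0_norm (pi_ge0 R)) (ger0_norm d0) ger0_norm//.
have pd : 0 <= 4 * pi * delta :> R by rewrite !mulr_ge0// pi_ge0.
by have := ler_wpM2l pd hX; lra.
Qed.

End LineConfig.

(** * Admissibility of half the signal difference as noise *)

Section NoiseLevel.
Variables (R : realType) (d s m : nat).
Implicit Types (p : \bar R) (g delta t eps : R).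

(** Both signs are needed because the two configurations reach the midpoint datum with opposite
    noise. *)
Lemma line_half_gap_noise p g delta t eps (q := @line_config R d s) :
  (0 < s)%N -> (0 < m)%N -> (1%:E <= p)%E -> 0 <= delta -> 0 <= t ->
  (t + 8 * pi * d%:R * m%:R * delta) / 2 *
    (5 ^+ d * (m%:R : R) `^ dim_div d p) <= eps ->
  let eta (x : grid d m) : R[i] := (signal (q g delta t) x - signal (q g 0 0) x) / 2 in
  noise_class p eps eta /\ noise_class p eps (fun x => - eta x).
Proof.
move=> s0 m0 p1 d0 t0 heps eta; set M := (_ / 2 : R) in heps.
have M0 : 0 <= M by rewrite /M divr_ge0// addr_ge0// !mulr_ge0// pi_ge0.
have etaM x : cmod (eta x) <= M.
  have c2 : cmod (2^-1 : R[i]) = 2^-1.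
    by rewrite (_ : 2^-1 = (2^-1 : R)%:C%C) ?cmod_real ?ger0_norm// fmorphV rmorph_nat.
  by rewrite /eta cmodM c2 ler_wpM2r// cmod_signal_line_gap.
have lp_le (f : data R d m) : (forall x, cmod (f x) <= M) -> noise_class p eps f.
  move=> fM; apply: le_trans (lp_norm_le p1 M0 fM) _; apply: le_trans heps.
  by rewrite ler_wpM2l// grid_side_powR_le.
by split; apply: lp_le => // x; rewrite cmodN.
Qed.

End NoiseLevel.

Theorem theorem6p2 (R : realType) (d : nat) (hd : (0 < d)%N) :
  exists c_d c_freq c_ampl : R,
    [/\ 0 < c_d, 0 < c_freq, 0 < c_ampl &
    forall (s m : nat) (beta : R),
      (2 <= s)%N -> 1 <= beta -> 2 * beta * s%:R <= m%:R ->
    forall (p : \bar R) (eps : R),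
      (1%:E <= p)%E -> 0 <= eps -> eps <= c_d * m%:R `^ dim_div d p ->
    forall match_ : config R d s -> config R d s -> 'S_s,
      best_match match_ ->
      ((c_freq * (eps / m%:R `^ (1 + dim_div d p)))%:E
         <= minimax_freq_error (@signal_class R d s m beta)
              (@noise_class R d m p eps) match_)%E /\
      ((c_ampl * (eps / m%:R `^ dim_div d p))%:E
         <= minimax_ampl_error (@signal_class R d s m beta)
              (@noise_class R d m p eps) match_)%E].
Proof.
have d1 : 1 <= d%:R :> R by rewrite ler1n.
have F1 : 1 <= 5 ^+ d :> R by rewrite exprn_ege1// ler1n.
set F : R := 5 ^+ d in F1 *.
have F0 : 0 < F by lra.
have d0 : 0 < d%:R :> R by lra.
have pi0 := pi_gt0 R; have pi_ge2 := pi_ge2 R.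
set K := 8 * pi * d%:R * F; have K0 : 0 < K by rewrite !mulr_gt0.
(* [K] and [F] are the factors in the noise bound for half the displacement and half the amplitude
   change, so these choices spend exactly the budget [eps]. *)
exists 1, K^-1, F^-1; split; rewrite ?invr_gt0//.
move=> s m beta s2 beta1 hm p eps p1 eps0; rewrite mul1r => heps match_ _.
have s0 : (0 < s)%N by exact: ltn_trans s2.
have s2R : 2 <= s%:R :> R by rewrite ler_nat.
have mR : 4 <= m%:R :> R by nra.
have mR0 : 0 < m%:R :> R by lra.
have m0 : (0 < m)%N by rewrite -(ltr0n R).
set P := m%:R `^ dim_div d p in heps *; have P0 : 0 < P by exact: powR_gt0.
have -> : m%:R `^ (1 + dim_div d p) = m%:R * P.
  by rewrite powRD ?powRr1// (gt_eqF mR0) implybT.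
set g := 2 * beta / m%:R.
have g0 : 0 < g by rewrite divr_gt0//; lra.
have g20 : 0 < g / 2 by rewrite divr_gt0.
have sg : s%:R * g <= 1 by rewrite /g mulrA ler_pdivrMr//; lra.
have S0 : signal_class m beta (line_config d s g 0 0).
  by apply: line_config_signal_class => //; rewrite ?lexx ?(ltW g20).
split.
- set h := 2 * (K^-1 * (eps / (m%:R * P))).
  have h0 : 0 <= h.
    by rewrite mulr_ge0// mulr_ge0 ?invr_ge0 ?(ltW K0)// divr_ge0// ltW// mulr_gt0.
  have hE : h * (K / 2) * (m%:R * P) = eps.
    by rewrite /h; field; rewrite !lt0r_neq0.
  (* From eps <= m^(d/p) and K >= 2 one gets h <= 1/m <= beta/m = g/2, so the displacement is
     allowed. *)
  have hm1 : h * m%:R <= 1.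
    have K2 : 1 <= K / 2.
      have -> : K / 2 = 4 * pi * (d%:R * F) by rewrite /K; field.
      by have := ler_peMl (ltW F0) d1; nra.
    rewrite -(ler_pM2r P0) mul1r -mulrA; apply: le_trans heps; rewrite -hE.
    by rewrite ler_wpM2r ?ler_peMr// ltW// mulr_gt0.
  have hg : h <= g / 2.
    rewrite (_ : g / 2 = beta / m%:R); last by rewrite /g; field; rewrite gt_eqF.
    by rewrite ler_pdivlMr//; lra.
  have [] := @line_half_gap_noise R d s m p g h 0 eps s0 m0 p1 h0 (lexx 0).
    by rewrite -/F -/P -hE le_eqVlt; apply/orP; left; apply/eqP; rewrite /K; field.
  move=> N1 N2.
  have S1 : signal_class m beta (line_config d s g h 0).
    by apply: line_config_signal_class => //; rewrite ?h0 ?hg.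
  apply: (two_point_lower_bound match_ S0 S1 N1 N2 (err := @freq_error R d s)).
  move=> q' pi1 pi2; rewrite -/h.
  apply: (@freq_error_lower_bound _ _ _ _ _ _ _ _ (Ordinal hd) (Ordinal s0)) => k.
  (* The original spike 0 is at least h from its displaced copy, because h <= 1 - h, and at least
     g/2 >= h from every other node. *)
  rewrite !tnth_freq_line; have [<-|lk] := eqVneq (Ordinal s0) k.
    rewrite -raddfB /line_node /= mulr0 mul0rn !add0r mulr1n.
    have g1 : g / 2 + g / 2 <= 1 by nra.
    apply: le_circle_norm_pi; rewrite normrN ger0_norm// lerBrDr.
    exact: le_trans (lerD hg hg) g1.
  apply: (le_trans hg); apply: circle_norm_line_node => //.
    by rewrite lexx ltW.
  by rewrite h0 hg.
- set e := F^-1 * (eps / P).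
  have e0 : 0 <= e by rewrite mulr_ge0 ?invr_ge0 ?(ltW F0)// divr_ge0// ltW.
  have eE : e * (F * P) = eps by rewrite /e; field; rewrite !lt0r_neq0.
  have t0 : 0 <= 2 * e by rewrite mulr_ge0.
  have [] := @line_half_gap_noise R d s m p g 0 (2 * e) eps s0 m0 p1 (lexx 0) t0.
    by rewrite -/F -/P mulr0 addr0 [2 * e]mulrC mulfK// eE.
  move=> N1 N2.
  have S1 : signal_class m beta (line_config d s g 0 (2 * e)).
    by apply: line_config_signal_class => //; rewrite ?lexx ?(ltW g20).
  apply: (two_point_lower_bound match_ S0 S1 N1 N2 (err := @ampl_error R d s)).
  move=> q' pi1 pi2.
  apply: (@ampl_error_lower_bound _ _ _ _ _ _ _ _ (Ordinal s0)) => k.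
  rewrite !ampl_line mul0rn -rmorphB cmod_real /= mulr1n addr0 addrAC subrr add0r.
  by rewrite ger0_norm.
Qed.
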